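(* Let $p$ be a prime, let $V$ be a finite-dimensional vector space over $\mathbb{Q}_p$, let $N$ be a norm on $V$, and let $\mathcal{L}=\mathcal{L}(\alpha_1,\dots,\alpha_n)$ be a $p$-adic lattice of rank $n$ in $V$ such that $\alpha_1,\dots,\alpha_n$ is an $N$-orthogonal basis of $\mathcal{L}$. Then a sequence $\beta_1,\dots,\beta_n$ is an $N$-orthogonal basis of $\mathcal{L}$ if and only if it can be obtained from $\alpha_1,\dots,\alpha_n$ by a finite sequence of the following operations: (1) $\alpha_i\leftarrow k\alpha_i$ for some $k\in\mathbb{Z}_p\setminus p\mathbb{Z}_p$; (2) $\alpha_i\leftrightarrow\alpha_j$ (swap two vectors); (3) $\alpha_i\leftarrow\alpha_i+k\alpha_j$ for some $j\neq i$ and some $k\in\mathbb{Z}_p$ with $N(k\alpha_j)\le N(\alpha_i)$.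
   Context: A norm on a $\mathbb{Q}_p$-vector space $V$ is a function $N:V\to\mathbb{R}$ with $N(v)\ge0$, $N(v)=0$ iff $v=0$; $N(xv)=|x|_p N(v)$ for $x\in\mathbb{Q}_p$; and $N(v+w)\le\max\{N(v),N(w)\}$. For $\mathbb{Q}_p$-linearly independent $\alpha_1,\dots,\alpha_m\in V$, the $p$-adic lattice $\mathcal{L}(\alpha_1,\dots,\alpha_m)=\{\sum_{i=1}^m a_i\alpha_i: a_i\in\mathbb{Z}_p\}$ has basis $\alpha_1,\dots,\alpha_m$ and rank $m$. A basis $\beta_1,\dots,\beta_m$ of a lattice is an $N$-orthogonal basis of it if $N(\sum_i x_i\beta_i)=\max_i N(x_i\beta_i)$ for all $x_i\in\mathbb{Q}_p$. *)

(* Defs.v *)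
From HB Require Import structures.
From Stdlib Require Export Relation_Operators.
From mathcomp Require Export all_boot all_order all_algebra.
From mathcomp Require Export boolp reals.

Set Implicit Arguments.
Unset Strict Implicit.
Unset Printing Implicit Defensive.

Import Order.TTheory GRing.Theory Num.Theory.

(* Z_p as the inverse limit of the rings Z/p^n: an element is the sequence of
   its least nonnegative residues, x n being the residue modulo p ^ n.  The
   proof that p is prime is a parameter of the type, so that the ring
   structures can be declared canonically. *)
Record padic_int (p : nat) (p_prime : prime p) := PadicInt {
  padic_res :> nat -> nat;
  _ : `[< forall n, padic_res n.+1 %% p ^ n = padic_res n >]
}.

HB.instance Definition _ p p_prime :=
  [isSub for @padic_res p p_prime].
HB.instance Definition _ p (p_prime : prime p) :=
  gen_eqMixin (padic_int p_prime).
HB.instance Definition _ p (p_prime : prime p) :=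
  gen_choiceMixin (padic_int p_prime).

Section PadicInt.
Variables (p : nat) (p_prime : prime p).
Local Notation Zp := (padic_int p_prime).
Implicit Types x y z : Zp.

Lemma padic_resP x n : x n.+1 %% p ^ n = x n.
Proof. by case: x => f /= /asboolP. Qed.

Lemma padic_res_mod x n : x n %% p ^ n = x n.
Proof. by rewrite -{1}padic_resP modn_mod padic_resP. Qed.

Lemma padic_res_le x m n : m <= n -> x n %% p ^ m = x m.
Proof.
move=> /subnK <-; elim: (n - m) => [|k IHk]; first exact: padic_res_mod.
by rewrite -IHk -(padic_resP x (k + m)) modn_dvdm // dvdn_exp2l ?leq_addl.
Qed.

Lemma padic_int_eqP x y : (forall n, x n = y n) -> x = y.
Proof. by move=> xy; apply: val_inj; apply: funext. Qed.

(* The p-adic integer given by a sequence of residues which is coherent up to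
   congruence. *)
Lemma padic_mk_subproof (f : nat -> nat) :
  (forall n, f n.+1 = f n %[mod p ^ n]) ->
  `[< forall n, (f n.+1 %% p ^ n.+1) %% p ^ n = f n %% p ^ n >].
Proof.
by move=> fP; apply/asboolP => n; rewrite modn_dvdm ?fP // dvdn_exp2l.
Qed.

Definition padic_mk (f : nat -> nat) fP : Zp :=
  PadicInt p_prime (@padic_mk_subproof f fP).

Fact padic_const_subproof (m : nat) (n : nat) : m = m %[mod p ^ n].
Proof. by []. Qed.
Definition padic_const m := padic_mk (padic_const_subproof m).

Fact padic_add_subproof x y n : x n.+1 + y n.+1 = x n + y n %[mod p ^ n].
Proof. by rewrite -modnDm !padic_resP. Qed.
Definition padic_add x y := padic_mk (padic_add_subproof x y).

Fact padic_opp_subproof x n :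
  p ^ n.+1 - x n.+1 = p ^ n - x n %[mod p ^ n].
Proof.
have lt_x k : x k <= p ^ k.
  by rewrite -padic_res_mod ltnW // ltn_pmod // expn_gt0 prime_gt0.
apply/eqP; rewrite -(eqn_modDr (x n.+1)) subnK //.
by rewrite -modnDmr padic_resP subnK // modnn expnS modnMl.
Qed.
Definition padic_opp x := padic_mk (padic_opp_subproof x).

Fact padic_mul_subproof x y n : x n.+1 * y n.+1 = x n * y n %[mod p ^ n].
Proof. by rewrite -modnMm !padic_resP. Qed.
Definition padic_mul x y := padic_mk (padic_mul_subproof x y).

Fact padic_addA : associative padic_add.
Proof. by move=> x y z; apply: padic_int_eqP => n /=; rewrite modnDmr modnDml addnA. Qed.
Fact padic_addC : commutative padic_add.
Proof. by move=> x y; apply: padic_int_eqP => n /=; rewrite addnC. Qed.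
Fact padic_add0 : left_id (padic_const 0) padic_add.
Proof. by move=> x; apply: padic_int_eqP => n /=; rewrite mod0n padic_res_mod. Qed.
Fact padic_addN : left_inverse (padic_const 0) padic_opp padic_add.
Proof.
move=> x; apply: padic_int_eqP => n /=; rewrite modnDml subnK ?modnn ?mod0n //.
by rewrite -padic_res_mod ltnW // ltn_pmod // expn_gt0 prime_gt0.
Qed.

HB.instance Definition _ :=
  GRing.isZmodule.Build Zp padic_addA padic_addC padic_add0 padic_addN.

Fact padic_mulA : associative padic_mul.
Proof. by move=> x y z; apply: padic_int_eqP => n /=; rewrite modnMmr modnMml mulnA. Qed.
Fact padic_mulC : commutative padic_mul.
Proof. by move=> x y; apply: padic_int_eqP => n /=; rewrite mulnC. Qed.
Fact padic_mul1 : left_id (padic_const 1) padic_mul.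
Proof.
by move=> x; apply: padic_int_eqP => n /=; rewrite modnMml mul1n padic_res_mod.
Qed.
Fact padic_mulDl : left_distributive padic_mul padic_add.
Proof.
by move=> x y z; apply: padic_int_eqP => n /=; rewrite modnMml modnDm mulnDl.
Qed.
Fact padic_1neq0 : padic_const 1 != padic_const 0.
Proof.
apply/eqP => /(congr1 (fun x : Zp => x 1)) /=.
by rewrite expn1 mod0n modn_small // prime_gt1.
Qed.

HB.instance Definition _ := GRing.Zmodule_isComNzRing.Build Zp
  padic_mulA padic_mulC padic_mul1 padic_mulDl padic_1neq0.

Lemma padic_res0 n : (0%R : Zp) n = 0.
Proof. by rewrite /= mod0n. Qed.

Lemma padic_resD x y n : (x + y)%R n = (x n + y n) %% p ^ n.
Proof. by []. Qed.

Lemma padic_resM x y n : (x * y)%R n = (x n * y n) %% p ^ n.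
Proof. by []. Qed.

Lemma padic_res_nat m n : (m%:R%R : Zp) n = m %% p ^ n.
Proof.
elim: m => [|m IHm]; first by rewrite padic_res0 mod0n.
by rewrite -natr1 padic_resD IHm /= modnDm addn1.
Qed.

Local Open Scope ring_scope.

Definition padic_unit : {pred Zp} := fun x => `[< exists y, y * x = 1 >].

Definition padic_inv x : Zp :=
  if pselect (exists y, y * x = 1) is left h then projT1 (cid h) else x.

Fact padic_mulV : {in padic_unit, left_inverse 1 padic_inv *%R}.
Proof.
move=> x /asboolP ux; rewrite /padic_inv.
by case: pselect => // h; exact: (projT2 (cid h)).
Qed.
Fact padic_unitP x y : y * x = 1 -> padic_unit x.
Proof. by move=> yx; apply/asboolP; exists y. Qed.
Fact padic_inv_out : {in [predC padic_unit], padic_inv =1 id}.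
Proof.
move=> x /negP nux; rewrite /padic_inv; case: pselect => // h.
by case: nux; apply/asboolP.
Qed.

HB.instance Definition _ := GRing.ComNzRing_hasMulInverse.Build Zp
  padic_mulV padic_unitP padic_inv_out.

Lemma padic_neq0 x : x != 0 -> exists n, x n.+1 != 0%N.
Proof.
move=> x0; apply: contrapT => nx; case/eqP: x0.
apply: padic_int_eqP => -[|n]; last first.
  by rewrite padic_res0; apply/eqP/negPn/negP => h; apply: nx; exists n.
by rewrite -(padic_resP x) -(padic_resP 0) expn0 !modn1.
Qed.

(* The valuation of x != 0: the largest n such that x is 0 modulo p ^ n. *)
Definition padic_int_val x : nat :=
  if pselect (exists n, x n.+1 != 0%N) is left h then ex_minn h else 0.

Lemma padic_int_valP x : x != 0 ->
  x (padic_int_val x) = 0%N /\ x (padic_int_val x).+1 != 0%N.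
Proof.
move=> /padic_neq0 h; rewrite /padic_int_val; case: pselect => // {}h.
case: ex_minnP => n xn min_n; split=> //.
case: n {xn} min_n => [|n] min_n; first by rewrite -padic_resP expn0 modn1.
by apply/eqP/negPn/negP => /min_n; rewrite ltnn.
Qed.

Lemma padic_int_val_eq x n : x n = 0%N -> x n.+1 != 0%N -> padic_int_val x = n.
Proof.
move=> xn xSn; have x0 : x != 0.
  by apply: contraNneq xSn => ->; rewrite padic_res0.
have [xv xSv] := padic_int_valP x0; case: (ltngtP (padic_int_val x) n) => // lt.
  by move: xSv; rewrite -(padic_res_le x lt) xn mod0n.
by move: xSn; rewrite -(padic_res_le x lt) xv mod0n.
Qed.

Lemma padic_logn x n : x n != 0%N -> logn p (x n) = padic_int_val x.
Proof.
move=> xn; have x0 : x != 0 by apply: contraNneq xn => ->; rewrite padic_res0.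
have [xv xSv] := padic_int_valP x0.
have lt_vn : (padic_int_val x < n)%N.
  by rewrite ltnNge; apply: contraNN xn => le_nv; rewrite -(padic_res_le x le_nv) xv mod0n.
have xn_gt0 : (0 < x n)%N by rewrite lt0n.
apply/eqP; rewrite eqn_leq -(pfactor_dvdn _ p_prime xn_gt0).
rewrite leqNgt -(pfactor_dvdn _ p_prime xn_gt0).
by rewrite /dvdn !padic_res_le ?(ltnW lt_vn) // xv eqxx xSv.
Qed.

Lemma padic_int_valM x y : x != 0 -> y != 0 ->
  x * y != 0 /\ padic_int_val (x * y) = (padic_int_val x + padic_int_val y)%N.
Proof.
move=> x0 y0; have [xv xSv] := padic_int_valP x0.
have [yv ySv] := padic_int_valP y0.
set v := padic_int_val x in xv xSv *; set w := padic_int_val y in yv ySv *.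
have nz z u n : z u.+1 != 0%N -> (u < n)%N -> z n != 0%N.
  by move=> zu lt; apply: contraNneq zu => zn; rewrite -(padic_res_le z lt) zn mod0n.
have xN : x (v + w).+1 != 0%N by rewrite (nz _ v) // ltnS leq_addr.
have yN : y (v + w).+1 != 0%N by rewrite (nz _ w) // ltnS leq_addl.
have xyS : (x * y) (v + w).+1 != 0%N.
  rewrite padic_resM; apply/negP; rewrite -/(dvdn _ _).
  by rewrite pfactor_dvdn ?muln_gt0 ?lt0n ?xN // lognM ?lt0n // !padic_logn // ltnn.
split; first by apply: contraNneq xyS => ->; rewrite padic_res0.
apply: padic_int_val_eq => //.
rewrite padic_resM; apply/eqP; rewrite -/(dvdn _ _) expnD dvdn_mul // /dvdn.
  by rewrite padic_res_le ?leq_addr // xv.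
by rewrite padic_res_le ?leq_addl // yv.
Qed.

Fact padic_int_integral : GRing.integral_domain_axiom Zp.
Proof.
move=> x y xy; apply/norP => -[x0 y0].
by have [] := padic_int_valM x0 y0; rewrite xy eqxx.
Qed.

HB.instance Definition _ :=
  GRing.ComUnitRing_isIntegral.Build Zp padic_int_integral.

End PadicInt.

Notation padic p_prime := {fraction (padic_int p_prime)}.
Notation "x %:F" := (@FracField.tofrac _ x) : ring_scope.

Local Open Scope ring_scope.

Section PadicAbs.
Variables (p : nat) (p_prime : prime p) (R : realType).
Local Notation Zp := (padic_int p_prime).
Local Notation Qp := (padic p_prime).

Definition padic_int_abs (x : Zp) : R :=
  if x == 0 then 0 else p%:R ^- padic_int_val x.

(* |n / d|_p = |n|_p / |d|_p; see padic_absE for the independence of the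
   representative. *)
Definition padic_abs (x : Qp) : R :=
  padic_int_abs \n_(repr x) / padic_int_abs \d_(repr x).

Let p_gt0 : 0 < p%:R :> R.
Proof. by rewrite ltr0n prime_gt0. Qed.

Lemma padic_int_abs_eq0 (x : Zp) : (padic_int_abs x == 0) = (x == 0).
Proof.
rewrite /padic_int_abs; case: ifP => _; first by rewrite eqxx.
by rewrite invr_eq0 expf_eq0 gt_eqF // andbF.
Qed.

Lemma padic_int_absM (x y : Zp) :
  padic_int_abs (x * y) = padic_int_abs x * padic_int_abs y.
Proof.
rewrite /padic_int_abs mulf_eq0.
have [->|x0] := eqVneq x 0; first by rewrite /= mul0r.
have [->|y0] := eqVneq y 0; first by rewrite orbT mulr0.
by have [_ ->] := padic_int_valM x0 y0; rewrite exprD invfM.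
Qed.

Lemma padic_fracE (x : Qp) : x = (\n_(repr x))%:F / (\d_(repr x))%:F.
Proof.
have d0 : \d_(repr x) != 0 by [].
apply/(canRL (mulfK _)); first by rewrite tofrac_eq0.
rewrite -{1}(reprK x); unlock FracField.tofrac; rewrite -[LHS]FracField.pi_mul.
apply/eqmodP/eqP; rewrite /FracField.mulf !numden_Ratio ?mulf_neq0 ?oner_eq0 //.
by rewrite !mulr1 mulrC.
Qed.

Lemma padic_absE (x y : Zp) : y != 0 ->
  padic_abs (x%:F / y%:F) = padic_int_abs x / padic_int_abs y.
Proof.
move=> y0; rewrite /padic_abs; set z := x%:F / y%:F.
have d0 : \d_(repr z) != 0 by [].
have /eqP : z = z by []; rewrite {2}(padic_fracE z) /z eqr_div ?tofrac_eq0 //.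
rewrite -/z -!tofracM tofrac_eq => /eqP /(congr1 padic_int_abs).
rewrite !padic_int_absM => e; apply/eqP.
by rewrite eqr_div ?padic_int_abs_eq0 // -e mulrC.
Qed.

Lemma padic_abs_tofrac (x : Zp) : padic_abs x%:F = padic_int_abs x.
Proof.
have abs1 : padic_int_abs 1 = 1.
  apply: (@mulfI _ (padic_int_abs 1)); first by rewrite padic_int_abs_eq0 oner_eq0.
  by rewrite -padic_int_absM !mulr1.
by rewrite -[x%:F]divr1 -tofrac1 padic_absE ?oner_eq0 // abs1 divr1.
Qed.

Lemma padic_abs_eq0 (x : Qp) : (padic_abs x == 0) = (x == 0).
Proof.
rewrite /padic_abs mulf_eq0 invr_eq0 !padic_int_abs_eq0.
by rewrite [x in RHS]padic_fracE mulf_eq0 invr_eq0 !tofrac_eq0.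
Qed.

Lemma padic_absM (x y : Qp) :
  padic_abs (x * y) = padic_abs x * padic_abs y.
Proof.
rewrite {1}(padic_fracE x) {1}(padic_fracE y) mulf_div -!tofracM.
by rewrite padic_absE ?mulf_neq0 ?denom_ratioP // !padic_int_absM mulf_div.
Qed.

Lemma padic_int_abs_le (x : Zp) n : x n = 0%N -> padic_int_abs x <= p%:R ^- n.
Proof.
rewrite /padic_int_abs => xn; have [_|x0] := eqVneq x 0.
  by rewrite invr_ge0 exprn_ge0 ?ltW.
have [_ xSv] := padic_int_valP x0.
rewrite lef_pV2 ?posrE ?exprn_gt0 //.
rewrite ler_eXn2l ?ltr1n ?prime_gt1 //.
rewrite leqNgt; apply: contraNN xSv => lt.
by rewrite -(padic_res_le x lt) xn mod0n.
Qed.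

Lemma padic_int_absD (x y : Zp) :
  padic_int_abs (x + y) <= Num.max (padic_int_abs x) (padic_int_abs y).
Proof.
wlog le_xy : x y / padic_int_abs x <= padic_int_abs y.
  move=> H; case/orP: (le_total (padic_int_abs x) (padic_int_abs y)) => /H //.
  by rewrite addrC maxC.
rewrite (max_idPr le_xy); have [y0|y0] := eqVneq y 0.
  by move: le_xy; rewrite y0 addr0.
have [yv _] := padic_int_valP y0.
rewrite {2}/padic_int_abs (negbTE y0); apply: padic_int_abs_le.
rewrite padic_resD yv addn0 padic_res_mod.
have [->|x0] := eqVneq x 0; first by rewrite padic_res0.
have [xv _] := padic_int_valP x0.
move: le_xy; rewrite /padic_int_abs (negbTE x0) (negbTE y0).
rewrite lef_pV2 ?posrE ?exprn_gt0 // ler_eXn2l ?ltr1n ?prime_gt1 // => le_yx.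
by rewrite -(padic_res_le x le_yx) xv mod0n.
Qed.

Lemma padic_absD (x y : Qp) :
  padic_abs (x + y) <= Num.max (padic_abs x) (padic_abs y).
Proof.
have ge0 (z : Zp) : 0 <= padic_int_abs z.
  by rewrite /padic_int_abs; case: ifP => // _; rewrite invr_ge0 exprn_ge0 ?ltW.
have dx0 : \d_(repr x) != 0 by []. have dy0 : \d_(repr y) != 0 by [].
rewrite {1}(padic_fracE x) {1}(padic_fracE y) addf_div ?tofrac_eq0 //.
rewrite -!tofracM -tofracD padic_absE ?mulf_neq0 ?denom_ratioP // ler_pdivrMr; last first.
  by rewrite lt_neqAle ge0 eq_sym padic_int_abs_eq0 mulf_neq0.
rewrite (le_trans (padic_int_absD _ _)) // maxr_pMl // /padic_abs !padic_int_absM.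
rewrite mulrA divfK ?padic_int_abs_eq0 //.
by rewrite [padic_int_abs \d_(repr x) * padic_int_abs _]mulrC mulrA divfK ?padic_int_abs_eq0.
Qed.

Lemma padic_absp : padic_abs p%:R = p%:R^-1.
Proof.
have p1 := prime_gt1 p_prime.
rewrite -(rmorph_nat (@FracField.tofrac Zp)) padic_abs_tofrac /padic_int_abs.
have p_2 : (p%:R : Zp) 2 != 0%N.
  by rewrite padic_res_nat modn_small ?expnS ?expn0 ?muln1 ?ltn_Pmull ?prime_gt0 // -lt0n prime_gt0.
rewrite ifF; last by apply: contraNF p_2 => /eqP ->; rewrite padic_res0.
by rewrite (padic_int_val_eq (n := 1)) // padic_res_nat expn1 modnn.
Qed.

End PadicAbs.

Section Lattices.
Variables (p : nat) (p_prime : prime p) (R : realType).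
Local Notation Zp := (padic_int p_prime).
Local Notation Qp := (padic p_prime).
Variable V : vectType Qp.

Record is_padic_norm (N : V -> R) : Prop := IsPadicNorm {
  padic_norm_ge0 : forall v, 0 <= N v;
  padic_norm_eq0 : forall v, N v = 0 <-> v = 0;
  padic_normZ : forall (x : Qp) v, N (x *: v) = padic_abs R x * N v;
  padic_norm_max : forall v w, N (v + w) <= Num.max (N v) (N w)
}.

Variable n : nat.
Implicit Types alpha beta : n.-tuple V.

Definition in_lattice alpha (v : V) : Prop :=
  exists a : 'I_n -> Zp, v = \sum_(i < n) (a i)%:F *: tnth alpha i.

Definition is_lattice_basis (L : V -> Prop) beta : Prop :=
  free beta /\ forall v, L v <-> in_lattice beta v.

Definition is_orthogonal_basis (N : V -> R) (L : V -> Prop) beta : Prop :=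
  is_lattice_basis L beta /\
  forall x : 'I_n -> Qp,
    N (\sum_(i < n) x i *: tnth beta i)
    = \big[Num.max/0]_(i < n) N (x i *: tnth beta i).

Definition update alpha (i : 'I_n) (v : V) : n.-tuple V :=
  [tuple if l == i then v else tnth alpha l | l < n].

(* The norm condition in the third operation is about the current vectors. *)
Inductive basis_step (N : V -> R) alpha : n.-tuple V -> Prop :=
| basis_scale (i : 'I_n) (k : Zp) of (~ exists l : Zp, k = p%:R * l) :
    basis_step N alpha (update alpha i (k%:F *: tnth alpha i))
| basis_swap (i j : 'I_n) :
    basis_step N alpha
      (update (update alpha i (tnth alpha j)) j (tnth alpha i))
| basis_add (i j : 'I_n) (k : Zp) of j != i
    & N (k%:F *: tnth alpha j) <= N (tnth alpha i) :
    basis_step N alpha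
      (update alpha i (tnth alpha i + k%:F *: tnth alpha j)).

Definition basis_reachable (N : V -> R) := clos_refl_trans _ (basis_step N).

End Lattices.

(* Main.v *)
(* Soundness is a direct computation.  Conversely, suppose [gamma] and [beta]
   are orthogonal bases of the same lattice and write
   [beta_j = \sum_i a_i gamma_i], [gamma_i = \sum_l b_il beta_l].  Then
   [\sum_i a_i b_ij = 1], so [a_i] and [b_ij] are both units for some [i], as
   the ring of p-adic integers is local.  Orthogonality of both bases gives
   [N beta_j = N gamma_i], and hence [N (a_l gamma_l) <= N gamma_i] for all
   [l]: the operations turn [gamma_i] into [beta_j].  If [gamma] and [beta]
   already agree at [l != j], then [b_lj = 0], so [i != l] and the agreement is
   not destroyed. *)
Require Import Defs.
From mathcomp Require Import perm cyclic.

Set Implicit Arguments.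
Unset Strict Implicit.
Unset Printing Implicit Defensive.

Import Order.TTheory GRing.Theory Num.Theory.
Local Open Scope ring_scope.

(** * Units of the p-adic integers, recognised by their residue modulo [p] *)

Section PadicIntUnits.
Variables (p : nat) (p_prime : prime p).
Local Notation Zp := (padic_int p_prime).
Implicit Types x y : Zp.

Lemma padic_dvdp x : x 1%N = 0%N -> exists y, x = p%:R * y.
Proof.
move=> x1; have p_gt0 := prime_gt0 p_prime.
(* Dividing by [p] costs one digit, so the quotient modulo [p ^ n] is read off the residue of [x]
   modulo [p ^ n.+1]. *)
have yP n : (x n.+2 %/ p = x n.+1 %/ p %[mod p ^ n])%N.
  by rewrite !modn_divl -expnSr padic_resP padic_res_mod.
exists (padic_mk p_prime yP); apply: padic_int_eqP => n.
rewrite padic_resM padic_res_nat /= modnMm mulnC divnK ?padic_resP //.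
by rewrite /dvdn -[X in (_ %% X)%N]expn1 padic_res_le // x1.
Qed.

Lemma padic_mulp_res1 y : (p%:R * y) 1%N = 0%N.
Proof. by rewrite padic_resM padic_res_nat expn1 modnn mul0n mod0n. Qed.

(** By Euler's theorem a power of the residue [x n] inverts it modulo [p ^ n]. These powers form a
    coherent sequence because inverses modulo [p ^ n] are unique. *)
Lemma padic_unit_res1 x : x 1%N != 0%N -> x \is a GRing.unit.
Proof.
move=> x1.
have x_coprime n : coprime (x n) (p ^ n).
  case: n => [|n]; first by rewrite expn0 coprimen1.
  rewrite coprime_sym coprimeXl // prime_coprime // /dvdn.
  by rewrite -[X in (_ %% X)%N]expn1 padic_res_le.
pose u n := (x n ^ (totient (p ^ n)).-1)%N.
have uK n : (u n * x n = 1 %[mod p ^ n])%N.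
  by rewrite /u -expnSr prednK ?totient_gt0 ?expn_gt0 ?prime_gt0 // Euler_exp_totient.
have uP n : (u n.+1 = u n %[mod p ^ n])%N.
  have u1 : (u n.+1 * x n = 1 %[mod p ^ n])%N.
    rewrite -(padic_resP x) modnMmr -(modn_dvdm _ (dvdn_exp2l p (leqnSn n))).
    by rewrite uK modn_dvdm // dvdn_exp2l.
  rewrite -[LHS]modn_mod -[u n.+1]muln1 -modnMmr -(uK n) modnMmr modn_mod mulnCA.
  by rewrite -modnMmr u1 modnMmr muln1.
apply/unitrPr; exists (padic_mk p_prime uP); apply: padic_int_eqP => n.
by rewrite mulrC padic_resM /= modnMml uK.
Qed.

(** Translates the condition on the scalar of the first operation into the residue test by which
    units are handled below. *)
Lemma padic_not_dvdp x : (~ exists y, x = p%:R * y) <-> x 1%N != 0%N.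
Proof.
split=> [nx | x1 [y xy]]; last by rewrite xy padic_mulp_res1 in x1.
by apply/eqP => /padic_dvdp.
Qed.

(** Locality of the ring: the elements with residue 0 modulo [p] are closed under addition and do
    not include 1. *)
Lemma padic_sum_unit (I : finType) (F : I -> Zp) :
  \sum_i F i = 1 -> exists i, F i 1%N != 0%N.
Proof.
move=> F1; apply: contrapT => nF.
have : (\sum_i F i) 1%N = 0%N.
  elim/big_ind: _ => [|x y x0 y0|i _].
  - by rewrite padic_res0.
  - by rewrite padic_resD x0 y0 mod0n.
  - by apply/eqP/negPn/negP => Fi; apply: nF; exists i.
by rewrite F1 /= expn1 modn_small // prime_gt1.
Qed.

Lemma padic_mul_res1 x y :
  (x * y) 1%N != 0%N -> x 1%N != 0%N /\ y 1%N != 0%N.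
Proof.
by rewrite padic_resM => xy; split; apply: contraNneq xy => ->;
   rewrite ?muln0 mod0n.
Qed.

Lemma padic_abs_unit (R : realType) x : x 1%N != 0%N -> padic_abs R x%:F = 1.
Proof.
move=> x1; have x0 : x != 0 by apply: contraNneq x1 => ->; rewrite padic_res0.
have v0 : padic_int_val x = 0%N.
  by apply: padic_int_val_eq => //; rewrite -padic_resP modn1.
by rewrite padic_abs_tofrac /padic_int_abs (negbTE x0) v0 expr0 invr1.
Qed.

End PadicIntUnits.

Section OrthogonalBases.
Variables (p : nat) (p_prime : prime p) (R : realType).
Local Notation Zp := (padic_int p_prime).
Local Notation Qp := (padic p_prime).
Variables (V : vectType Qp) (n : nat).
Implicit Types (alpha beta gamma : n.-tuple V) (L : V -> Prop).

(** * Lattice membership and linear independence in coordinates *)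

Lemma tnth_update alpha i v l :
  tnth (update alpha i v) l = if l == i then v else tnth alpha l.
Proof. by rewrite tnth_mktuple. Qed.

Lemma in_lattice_tnth alpha i : in_lattice alpha (tnth alpha i).
Proof.
exists (fun l => (l == i)%:R).
rewrite (bigD1 i) //= eqxx tofrac1 scale1r big1 ?addr0 // => l /negbTE ->.
by rewrite tofrac0 scale0r.
Qed.

Lemma in_latticeD alpha v w :
  in_lattice alpha v -> in_lattice alpha w -> in_lattice alpha (v + w).
Proof.
move=> [a ->] [b ->]; exists (fun i => a i + b i).
by rewrite -big_split; apply: eq_bigr => i _; rewrite tofracD scalerDl.
Qed.

Lemma in_latticeZ alpha (k : Zp) v :
  in_lattice alpha v -> in_lattice alpha (k%:F *: v).
Proof.
move=> [a ->]; exists (fun i => k * a i).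
by rewrite scaler_sumr; apply: eq_bigr => i _; rewrite tofracM scalerA.
Qed.

Lemma in_lattice_sub alpha beta v :
  (forall i, in_lattice alpha (tnth beta i)) ->
  in_lattice beta v -> in_lattice alpha v.
Proof.
move=> sub [b ->]; elim/big_ind: _ => [||i _]; last exact: in_latticeZ.
  exists (fun=> 0); rewrite big1 // => i _; by rewrite tofrac0 scale0r.
exact: in_latticeD.
Qed.

Lemma free_tnthP beta :
  free beta <-> forall x : 'I_n -> Qp,
    \sum_i x i *: tnth beta i = 0 -> forall i, x i = 0.
Proof.
have E x : \sum_(i < n) x i *: tnth beta i = \sum_(i < n) x i *: beta`_i.
  by apply: eq_bigr => i _; rewrite (tnth_nth 0).
by split=> [/freeP H x | H]; [rewrite E; apply: H | apply/freeP => x; rewrite -E; apply: H].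
Qed.

(** * Norms of vectors and a one-sided form of orthogonality *)

Variable N : V -> R.
Hypothesis hN : is_padic_norm N.

Lemma padic_norm0 : N 0 = 0. Proof. exact/(padic_norm_eq0 hN). Qed.

Lemma padic_norm_unitZ (k : Zp) v : k 1%N != 0%N -> N (k%:F *: v) = N v.
Proof. by move=> k1; rewrite (padic_normZ hN) padic_abs_unit // mul1r. Qed.

Lemma padic_normN v : N (- v) = N v.
Proof.
rewrite -scaleN1r -tofrac1 -tofracN padic_norm_unitZ //.
(* The residue of -1 modulo [p] is nonzero, since -1 is a factor of 1 = (-1)(-1). *)
apply: (proj1 (padic_mul_res1 (y := -1) _)).
by rewrite mulrNN mulr1 /= expn1 modn_small ?prime_gt1.
Qed.

Lemma padic_norm_le_scale (x : Qp) v w : N v <= N w -> N (x *: v) <= N (x *: w).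
Proof.
move=> vw; rewrite !(padic_normZ hN) ler_wpM2l // divr_ge0 //.
  rewrite /padic_int_abs; case: ifP => // _.
  by rewrite invr_ge0 exprn_ge0 ?ler0n.
rewrite /padic_int_abs; case: ifP => // _.
by rewrite invr_ge0 exprn_ge0 ?ler0n.
Qed.

Lemma padic_norm_leD v w (c : R) : N v <= c -> N w <= c -> N (v + w) <= c.
Proof.
by move=> vc wc; rewrite (le_trans (padic_norm_max hN _ _)) // ge_max vc.
Qed.

(* The inequality [N (\sum_i v_i) <= \max_i N v_i] always holds. *)
Lemma orthogonal_basisP L beta :
  is_orthogonal_basis N L beta <->
  [/\ forall v, L v <-> in_lattice beta v,
      forall i, tnth beta i != 0
    & forall (x : 'I_n -> Qp) i,
        N (x i *: tnth beta i) <= N (\sum_l x l *: tnth beta l)].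
Proof.
split=> [[[fb Lb] Nb] | [Lb b0 Nb]].
  split=> // [i|x i]; last by rewrite Nb; apply: le_bigmax.
  by rewrite (free_not0 fb) // mem_tnth.
split.
  (* If the sum is 0, each term has norm at most [N 0], which is 0, so its coefficient vanishes. *)
  split=> //; apply/free_tnthP => x x0 i; apply/eqP.
  have := Nb x i; rewrite x0 padic_norm0 => Ni.
  have /(padic_norm_eq0 hN)/eqP : N (x i *: tnth beta i) = 0.
    by apply/eqP; rewrite eq_le Ni (padic_norm_ge0 hN).
  by rewrite scaler_eq0 (negbTE (b0 i)) orbF.
move=> x; apply/le_anti/andP; split; last first.
  by apply: bigmax_le => [|i _]; [exact: padic_norm_ge0 | exact: Nb].
apply: (big_ind2 (fun v c => N v <= c)) => [|v c w d vc wd|//].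
  by rewrite padic_norm0.
by apply: padic_norm_leD; rewrite le_max ?vc ?wd ?orbT.
Qed.

(** * The three operations preserve orthogonal bases *)

Lemma in_lattice_update beta i v :
  in_lattice beta v -> in_lattice (update beta i v) (tnth beta i) ->
  forall w, in_lattice beta w <-> in_lattice (update beta i v) w.
Proof.
move=> bv bi w; split; apply: in_lattice_sub => l; last first.
  by rewrite tnth_update; case: eqP => // _; apply: in_lattice_tnth.
have [-> //|li] := eqVneq l i.
have -> : tnth beta l = tnth (update beta i v) l.
  by rewrite tnth_update (negbTE li).
exact: in_lattice_tnth.
Qed.

Lemma orthogonal_basis_scale L beta i (k : Zp) : k 1%N != 0%N ->
  is_orthogonal_basis N L beta ->
  is_orthogonal_basis N L (update beta i (k%:F *: tnth beta i)).
Proof.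
move=> k1 /orthogonal_basisP [Lb b0 Nb]; apply/orthogonal_basisP.
set gamma := update _ _ _; split=> [v|l|x l].
- rewrite Lb; apply: in_lattice_update; first exact/in_latticeZ/in_lattice_tnth.
  rewrite -/gamma; have -> : tnth beta i = (k^-1)%:F *: tnth gamma i.
    by rewrite tnth_update eqxx scalerA -tofracM mulVr ?padic_unit_res1 // tofrac1 scale1r.
  exact/in_latticeZ/in_lattice_tnth.
- rewrite tnth_update; have [_|//] := eqVneq l i; rewrite scaler_eq0 (negbTE (b0 i)) orbF.
  by rewrite tofrac_eq0; apply: contraNneq k1 => ->; rewrite padic_res0.
- pose y l := if l == i then x i * k%:F else x l.
  have E m : x m *: tnth gamma m = y m *: tnth beta m.
    by rewrite tnth_update /y; case: eqP => // ->; rewrite scalerA.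
  by rewrite E (eq_bigr _ (fun m _ => E m)).
Qed.

Lemma orthogonal_basis_swap L beta i j : is_orthogonal_basis N L beta ->
  is_orthogonal_basis N L (update (update beta i (tnth beta j)) j (tnth beta i)).
Proof.
move=> /orthogonal_basisP [Lb b0 Nb]; apply/orthogonal_basisP.
set gamma := update _ _ _.
(* Reading the double update as a transposition of indices also covers [i = j] and reduces
   orthogonality to a reindexing. *)
have E l : tnth gamma l = tnth beta (tperm i j l).
  rewrite !tnth_update; case: tpermP => [->|->|/eqP/negbTE -> /eqP/negbTE -> //].
    by rewrite eqxx; case: eqP => // ->.
  by rewrite eqxx.
split=> [v|l|x l].
- rewrite Lb; split; apply: in_lattice_sub => l.
    by rewrite -[l](tpermK i j) -E; apply: in_lattice_tnth.
  by rewrite E; apply: in_lattice_tnth.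
- by rewrite E.
- rewrite E (reindex_inj (@perm_inj _ (tperm i j))) /=.
  under eq_bigr do rewrite E tpermK.
  by rewrite -{1}[l](tpermK i j); apply: (Nb (x \o tperm i j)).
Qed.

(** The left vector is an orthogonal component of the sum. This shows that an addition never
    produces 0 and never lowers the norm of the modified vector. *)
Lemma orthogonal_norm_ge L beta i j (k : Zp) : j != i ->
  is_orthogonal_basis N L beta ->
  N (tnth beta i) <= N (tnth beta i + k%:F *: tnth beta j).
Proof.
move=> ji /orthogonal_basisP [_ _ Nb].
pose x l : Qp := if l == i then 1 else if l == j then k%:F else 0.
have := Nb x i; rewrite (bigD1 i) // (bigD1 j) //= big1 => [|l /andP[li lj]].
  by rewrite /x eqxx (negbTE ji) eqxx scale1r addr0.
by rewrite /x (negbTE li) (negbTE lj) scale0r.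
Qed.

(** Passing from coordinates in the new basis to those in [beta] changes only the coefficient at
    [j], by [x i * k%:F]. The norm condition keeps this correction below the norm of the whole
    sum. *)
Lemma orthogonal_basis_add L beta i j (k : Zp) : j != i ->
  N (k%:F *: tnth beta j) <= N (tnth beta i) ->
  is_orthogonal_basis N L beta ->
  is_orthogonal_basis N L (update beta i (tnth beta i + k%:F *: tnth beta j)).
Proof.
move=> ji Nk bP; have := bP.
move=> /orthogonal_basisP [Lb b0 Nb]; apply/orthogonal_basisP.
set gamma := update _ _ _.
have gi : tnth gamma i = tnth beta i + k%:F *: tnth beta j.
  by rewrite tnth_update eqxx.
have g l : l != i -> tnth gamma l = tnth beta l.
  by move=> li; rewrite tnth_update (negbTE li).
split=> [v|l|x].
- rewrite Lb; apply: in_lattice_update.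
    by apply: in_latticeD; [|apply: in_latticeZ]; apply: in_lattice_tnth.
  rewrite -/gamma; have -> : tnth beta i = tnth gamma i + (- k)%:F *: tnth gamma j.
    by rewrite gi (g j) // tofracN scaleNr addrK.
  by apply: in_latticeD; [|apply: in_latticeZ]; apply: in_lattice_tnth.
- have [->|/g -> //] := eqVneq l i.
  apply: contra_neq (b0 i); rewrite gi => gi0; apply/(padic_norm_eq0 hN)/le_anti.
  by rewrite (padic_norm_ge0 hN) (le_trans (orthogonal_norm_ge k ji bP)) // gi0 padic_norm0.
pose y l := if l == j then x j + x i * k%:F else x l.
have -> : \sum_l x l *: tnth gamma l = \sum_l y l *: tnth beta l.
  rewrite (bigD1 i) //= (bigD1 j) //= [RHS](bigD1 i) //= [in RHS](bigD1 j) //=.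
  rewrite gi g // /y eqxx eq_sym (negbTE ji) scalerDr scalerDl scalerA !addrA.
  congr (_ + _); first by rewrite -!addrA; congr (_ + _); rewrite addrC.
  by apply: eq_bigr => l /andP[li lj]; rewrite g // (negbTE lj).
have yi : N (x i *: tnth beta i) <= N (\sum_l y l *: tnth beta l).
  by have := Nb y i; rewrite /y eq_sym (negbTE ji).
(* The norm condition enters here, scaled by [x i]. *)
have yij : N ((x i * k%:F) *: tnth beta j) <= N (\sum_l y l *: tnth beta l).
  by rewrite -scalerA (le_trans (padic_norm_le_scale _ Nk)).
move=> l; have [->|li] := eqVneq l i.
  by rewrite gi scalerDr scalerA padic_norm_leD.
rewrite g //; have [lj|lj] := eqVneq l j; last first.
  by have := Nb y l; rewrite {1}/y (negbTE lj).
(* Both terms of this difference are already bounded by the norm of the sum. *)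
have -> : x l *: tnth beta l = y j *: tnth beta j - (x i * k%:F) *: tnth beta j.
  by rewrite lj /y eqxx scalerDl addrK.
by apply: padic_norm_leD => //; rewrite padic_normN.
Qed.

Lemma orthogonal_basis_step L beta gamma :
  basis_step N beta gamma -> is_orthogonal_basis N L beta ->
  is_orthogonal_basis N L gamma.
Proof.
case=> [i k /padic_not_dvdp|i j|i j k].
- exact: orthogonal_basis_scale.
- exact: orthogonal_basis_swap.
- exact: orthogonal_basis_add.
Qed.

Lemma orthogonal_basis_reachable L beta gamma :
  basis_reachable N beta gamma -> is_orthogonal_basis N L beta ->
  is_orthogonal_basis N L gamma.
Proof.
elim=> [b c|//|b c d _ IHbc _ IHcd bP]; first exact: orthogonal_basis_step.
exact/IHcd/IHbc.
Qed.

(** * From one orthogonal basis to another by operations *)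

Lemma reachable_add_sum L (s : seq 'I_n) beta i (a : 'I_n -> Zp) : i \notin s ->
  is_orthogonal_basis N L beta ->
  (forall l, l \in s -> N ((a l)%:F *: tnth beta l) <= N (tnth beta i)) ->
  basis_reachable N beta
    (update beta i (tnth beta i + \sum_(l <- s) (a l)%:F *: tnth beta l)).
Proof.
elim: s beta => [|j s IHs] beta /=.
  move=> _ _ _; rewrite big_nil addr0.
  have -> : update beta i (tnth beta i) = beta; last exact: rt_refl.
  by apply: eq_from_tnth => l; rewrite tnth_update; case: eqP => // ->.
rewrite inE eq_sym => /norP[ji i_s] bP Na.
have Nj : N ((a j)%:F *: tnth beta j) <= N (tnth beta i).
  by rewrite Na // mem_head.
pose gamma := update beta i (tnth beta i + (a j)%:F *: tnth beta j).
have gi : tnth gamma i = tnth beta i + (a j)%:F *: tnth beta j.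
  by rewrite tnth_update eqxx.
have g l : l \in s -> tnth gamma l = tnth beta l.
  by move=> ls; rewrite tnth_update; case: eqP i_s => // <-; rewrite ls.
apply: rt_trans (rt_step _ _ _ _ (basis_add ji Nj)) _; rewrite -/gamma.
have -> : update beta i (tnth beta i + \sum_(l <- j :: s) (a l)%:F *: tnth beta l)
  = update gamma i (tnth gamma i + \sum_(l <- s) (a l)%:F *: tnth gamma l).
  apply: eq_from_tnth => l; rewrite !tnth_update; case: eqP => // _.
  rewrite eqxx big_cons addrA; congr (_ + _).
  by apply: eq_big_seq => m /g ->.
apply: IHs => // [|l ls]; first exact: orthogonal_basis_add.
rewrite g // gi (le_trans _ (orthogonal_norm_ge _ ji bP)) // Na //.
by rewrite inE ls orbT.
Qed.

(** A Steinitz-type exchange: [i] is a position of [gamma] where [tnth beta j] can be built. The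
    last clause keeps [i] away from the other positions where the bases already agree. *)
Lemma exchange_index L beta gamma j :
  is_orthogonal_basis N L beta -> is_orthogonal_basis N L gamma ->
  exists (a : 'I_n -> Zp) (i : 'I_n),
    [/\ tnth beta j = \sum_l (a l)%:F *: tnth gamma l, a i 1%N != 0%N,
        forall l, N ((a l)%:F *: tnth gamma l) <= N (tnth gamma i)
      & i != j -> tnth gamma i <> tnth beta i].
Proof.
move=> bP gP; have [[fb _] _] := bP.
have /orthogonal_basisP [Lb _ Nb] := bP; have /orthogonal_basisP [Lg _ Ng] := gP.
have [a ja] : in_lattice gamma (tnth beta j) by apply/Lg/Lb/in_lattice_tnth.
have /choice [b gb] : forall i, in_lattice beta (tnth gamma i).
  by move=> i; apply/Lb/Lg/in_lattice_tnth.
have ab1 : \sum_i a i * b i j = 1.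
  (* The difference of two coordinate vectors of [tnth beta j]: the one obtained through [gamma],
     and the trivial one. *)
  pose x l : Qp := (\sum_i a i * b i l)%:F - (l == j)%:R.
  have x0 : \sum_l x l *: tnth beta l = 0.
    rewrite (eq_bigr _ (fun l _ => scalerBl _ _ _)) big_split sumrN /=.
    apply/eqP; rewrite subr_eq0; apply/eqP; rewrite [RHS](bigD1 j) //=.
    rewrite eqxx scale1r [in RHS]big1 ?addr0 => [|l /negbTE ->]; last by rewrite scale0r.
    rewrite ja; under [RHS]eq_bigr do rewrite {1}gb scaler_sumr.
    rewrite exchange_big /=; apply: eq_bigr => l _.
    rewrite rmorph_sum scaler_suml; apply: eq_bigr => i _.
    by rewrite scalerA -tofracM.
  move/free_tnthP/(_ _ x0 j)/eqP: fb; rewrite /x eqxx subr_eq0 -tofrac1.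
  by rewrite tofrac_eq => /eqP.
have [i /padic_mul_res1[ai bij]] := padic_sum_unit ab1.
(* As [b i j] is a unit, the left side is the norm of one term in the expansion of [tnth gamma i]
   along [beta]. *)
have Ngb : N (tnth beta j) <= N (tnth gamma i).
  by rewrite [in leRHS]gb -(padic_norm_unitZ _ bij); apply: Nb.
exists a, i; split=> // [l|ij gi].
  by rewrite (le_trans _ Ngb) // ja; apply: Ng.
(* Agreement at [i] makes this combination vanish. Its coefficient at [j], which differs from [i],
   is the unit [b i j], a contradiction. *)
have := fb => /free_tnthP /(_ (fun l => (b i l)%:F - (l == i)%:R)).
rewrite (eq_bigr _ (fun l _ => scalerBl _ _ _)) big_split sumrN /= -gb gi.
rewrite (bigD1 i) //= eqxx scale1r big1 => [|l /negbTE ->]; last by rewrite scale0r.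
rewrite addr0 subrr => /(_ erefl j); rewrite eq_sym (negbTE ij) subr0 => /eqP.
by rewrite tofrac_eq0 => /eqP bij0; rewrite bij0 padic_res0 in bij.
Qed.

(** The vector wanted at position [m] is built at some position [i], then swapped into place. Since
    [m <= i], the first [m] vectors survive. *)
Lemma reachable_replace L beta gamma (m : nat) (mn : (m < n)%N) :
  is_orthogonal_basis N L beta -> is_orthogonal_basis N L gamma ->
  (forall l : 'I_n, (l < m)%N -> tnth gamma l = tnth beta l) ->
  exists2 delta, basis_reachable N gamma delta
    & forall l : 'I_n, (l < m.+1)%N -> tnth delta l = tnth beta l.
Proof.
move=> bP gP gb; pose j := Ordinal mn.
have [a [i [ja ai Na gi]]] := exchange_index j bP gP.
have mi : (m <= i)%N.
  rewrite leqNgt; apply/negP => im; have ij : i != j by rewrite -val_eqE neq_ltn im.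
  exact: gi ij (gb _ im).
(* Scaling comes first because an addition leaves the coefficient of the modified vector equal to 1.
   The factor [a i] is a unit, so the norm bounds persist. *)
pose gamma1 := update gamma i ((a i)%:F *: tnth gamma i).
have g1 l : l != i -> tnth gamma1 l = tnth gamma l.
  by move=> li; rewrite tnth_update (negbTE li).
have g1i : tnth gamma1 i = (a i)%:F *: tnth gamma i by rewrite tnth_update eqxx.
pose s := [seq l <- index_enum 'I_n | l != i].
have in_s l : l \in s -> l != i by rewrite mem_filter => /andP[].
pose gamma2 := update gamma1 i
  (tnth gamma1 i + \sum_(l <- s) (a l)%:F *: tnth gamma1 l).
have g2i : tnth gamma2 i = tnth beta j.
  rewrite tnth_update eqxx g1i ja (bigD1 i) //=; congr (_ + _).
  by rewrite big_filter; apply: eq_bigr => l /g1 ->.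
exists (update (update gamma2 i (tnth gamma2 j)) j (tnth gamma2 i)); last first.
  move=> l; rewrite ltnS tnth_update; have [->|lj] := eqVneq l j.
    by rewrite g2i.
  rewrite !tnth_update => lm'; have lm : (l < m)%N by rewrite ltn_neqAle lm' andbT (val_eqE l j).
  have /negbTE li : l != i by rewrite -val_eqE neq_ltn (leq_trans lm mi).
  by rewrite li gb.
apply: rt_trans (rt_step _ _ _ _ (basis_swap _ _ i j)).
apply: (@rt_trans _ _ _ gamma1); first by apply/rt_step/basis_scale/padic_not_dvdp.
apply: (@reachable_add_sum L) => [||l ls].
- by apply/negP => /in_s; rewrite eqxx.
- exact: orthogonal_basis_scale.
- by rewrite g1 ?in_s // g1i [leRHS]padic_norm_unitZ // Na.
Qed.

Lemma orthogonal_bases_reachable L alpha beta :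
  is_orthogonal_basis N L alpha -> is_orthogonal_basis N L beta ->
  basis_reachable N alpha beta.
Proof.
move=> aP bP.
have reach m : (m <= n)%N -> exists2 gamma, basis_reachable N alpha gamma
    & forall l : 'I_n, (l < m)%N -> tnth gamma l = tnth beta l.
  elim: m => [_|m IHm mn]; first by exists alpha => //; apply: rt_refl.
  have [gamma ag gb] := IHm (ltnW mn).
  (* The next exchange needs the intermediate basis to be orthogonal, which soundness provides. *)
  have gP := orthogonal_basis_reachable ag aP.
  have [delta gd db] := reachable_replace mn bP gP gb.
  by exists delta => //; apply: rt_trans gd.
have [gamma ag gb] := reach n (leqnn n).
have <- // : gamma = beta.
by apply: eq_from_tnth => l; apply: gb.
Qed.

End OrthogonalBases.

Theorem theorem5p1 (p : nat) (p_prime : prime p) (R : realType)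
  (V : vectType (padic p_prime)) (N : V -> R) (hN : is_padic_norm N)
  (n : nat) (alpha : n.-tuple V) (halpha : free alpha)
  (halpha_orth : is_orthogonal_basis N (in_lattice alpha) alpha)
  (beta : n.-tuple V) :
  is_orthogonal_basis N (in_lattice alpha) beta
  <-> basis_reachable N alpha beta.
Proof.
split; first exact: orthogonal_bases_reachable.
by move=> /(orthogonal_basis_reachable hN); apply.
Qed.
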